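(* Let $k\ge 3$ be an integer and let $S$ be a set of integers containing no arithmetic progression of length $k$. Let $c$ be a real number with $1<c<\frac{k}{k-1}$. Then there exists $N_0$ such that for every integer $N\ge N_0$ the following holds: if $a_0$ is a non-negative integer and $A=\{a_1,\ldots,a_d\}$ is a set of $d$ distinct positive integers such that \[ H(a_0;a_1,\ldots,a_d) := \Big\{ a_0+\sum_{i=1}^d \epsilon_i a_i : \epsilon_i\in\{0,1\}\Big\} \subseteq S\cap[1,N], \] then \[ d\le \frac{2(k-2)}{(k-1)\log c}\log N. \]
   Context: An arithmetic progression of length $k$ is a set $\{b, b+h, \ldots, b+(k-1)h\}$ with $b,h$ integers and $h\neq 0$. $\log$ denotes the natural logarithm. *)

(* Defs.v *)
From HB Require Import structures.
From mathcomp Require Import all_boot all_order all_algebra.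
From mathcomp Require Import all_classical all_reals all_analysis.

Set Implicit Arguments.
Unset Strict Implicit.
Unset Printing Implicit Defensive.

Import Order.TTheory GRing.Theory Num.Theory.

Local Open Scope classical_set_scope.
Local Open Scope ring_scope.

Definition arith_prog (k : nat) (P : set int) : Prop :=
  exists b h : int, h != 0 /\ P = [set b + h *+ i | i in `I_k].

Definition AP_free (k : nat) (S : set int) : Prop :=
  ~ exists P : set int, arith_prog k P /\ P `<=` S.

(* The booleans eps i encode coefficients in {0, 1}: x *+ true = x and
   x *+ false = 0. *)
Definition hilbert_cube (d : nat) (a0 : int) (a : 'I_d -> int) : set int :=
  [set x | exists eps : 'I_d -> bool, x = a0 + \sum_(i < d) a i *+ eps i].

(* Main.v *)
Require Import Defs.
From HB Require Import structures.
From mathcomp Require Import all_boot all_order all_algebra.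
From mathcomp Require Import all_classical all_reals all_analysis.
From mathcomp Require Import zify lra.

Set Implicit Arguments.
Unset Strict Implicit.
Unset Printing Implicit Defensive.

Import Order.TTheory GRing.Theory Num.Theory.

Local Open Scope classical_set_scope.
Local Open Scope ring_scope.

(** If X is a finite set without k-term progressions and h is nonzero, then X
    splits into maximal chains of step h, each with at most k-1 elements, and
    X + h contains the successor of the last element of every chain. Hence
    the union of X and X + h has at least k/(k-1) |X| elements. Building the
    cube one generator at a time gives (k/(k-1))^d <= N, i.e.
    d log(k/(k-1)) <= log N; this is stronger than the claim because
    c < k/(k-1) and 2(k-2) >= k-1 for k >= 3. *)

Lemma AP_freeP (k : nat) (S : set int) (x h : int) :
  AP_free k S -> h != 0 -> exists2 j : nat, (j < k)%N & ~ S (x + h *+ j).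
Proof.
move=> hS h0; apply: contrapT => hn; apply: hS.
exists [set x + h *+ i | i in `I_k]; split; first by exists x, h.
move=> _ [j /= jk <-]; apply: contrapT => hj; apply: hn.
by exists j.
Qed.

Lemma AP_free_shift_growth (k : nat) (S : set int) (X : seq int) (h : int) :
  AP_free k S -> h != 0 -> (forall x, x \in X -> S x) -> uniq X ->
  exists Y : seq int, [/\ uniq Y, (k * size X <= k.-1 * size Y)%N &
    forall y, y \in Y -> y \in X \/ y - h \in X].
Proof.
move=> hS h0 XS uX.
(* [T] holds the points of [X + h] outside [X], one past the end of each maximal chain. *)
pose T := [seq y <- map (+%R^~ h) X | y \notin X].
have uT : uniq T by rewrite filter_uniq // map_inj_uniq //; exact: addIr.
(* Every point of [X] lies between 1 and [k.-1] steps before a point of [T], so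
   [size X <= k.-1 * size T]. Adding [k.-1 * size X] to both sides gives the growth. *)
have cov : {subset X <= [seq t - h *+ j | t <- T, j <- iota 1 k.-1]}.
  move=> x xX.
  have ex : exists j : nat, x + h *+ j \notin X.
    have [j _ nS] := AP_freeP x hS h0.
    by exists j; apply/negP => /XS.
  (* At the least index leaving [X], the preceding point is still in [X], so the exit point lies in
     [T]. *)
  case: (ex_minnP ex) => -[|j]; first by rewrite mulr0n addr0 xX.
  move=> jX jmin.
  have jk : (j.+1 < k)%N.
    have [i ik nS] := AP_freeP x hS h0.
    by apply: leq_ltn_trans ik; apply: jmin; apply/negP => /XS.
  have xE : x = x + h *+ j.+1 - h *+ j.+1 by rewrite addrK.
  rewrite [X in X \in _]xE; apply: (allpairs_f (fun t i => t - h *+ i)).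
    rewrite mem_filter jX; apply/mapP; exists (x + h *+ j).
      by apply: contraT => /jmin; rewrite ltnn.
    by rewrite mulrSr addrA.
  by rewrite mem_iota; lia.
have := uniq_leq_size uX cov; rewrite size_allpairs size_iota => hXT.
exists (X ++ T); split.
- rewrite cat_uniq uX uT andbT /=; apply/hasPn => t.
  by rewrite mem_filter => /andP[].
- rewrite size_cat mulnDr [(k.-1 * size T)%N]mulnC.
  (* Only [0 < k] is extracted here, to write [k] as [k.-1.+1]. *)
  have [j jk _] := AP_freeP 0 hS h0.
  by rewrite -{1}(ltn_predK jk) mulSn addnC leq_add2l.
- move=> y; rewrite mem_cat mem_filter => /orP[|/andP[_ /mapP[x xX ->]]].
    by left.
  by right; rewrite addrK.
Qed.

Lemma hilbert_cube_large (k d : nat) (S : set int) (a0 : int)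
    (a : 'I_d -> int) :
  AP_free k S -> (forall i, a i != 0) -> hilbert_cube a0 a `<=` S ->
  exists X : seq int, [/\ uniq X, (k ^ d <= k.-1 ^ d * size X)%N &
    forall x, x \in X -> hilbert_cube a0 a x].
Proof.
move=> hS ha cubeS.
(* Induction on the number [n] of generators in use: coefficients from index [n] on are off, so each
   partial cube stays inside the full cube, hence inside [S]. *)
suff /(_ d (leqnn d))[X [uX sX HX]] : forall n, (n <= d)%N ->
    exists X : seq int, [/\ uniq X, (k ^ n <= k.-1 ^ n * size X)%N &
    forall x, x \in X ->
    exists2 eps : 'I_d -> bool, (forall i : 'I_d, (n <= i)%N -> ~~ eps i) &
      x = a0 + \sum_(i < d) a i *+ eps i].
  by exists X; split=> // x /HX[eps _ ->]; exists eps.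
elim=> [_|n IHn nd].
  exists [:: a0]; split=> // x; rewrite inE => /eqP ->.
  by exists (fun=> false) => //; rewrite big1 ?addr0.
have [X [uX sX HX]] := IHn (ltnW nd).
have XS x : x \in X -> S x by move=> /HX[eps _ ->]; apply: cubeS; exists eps.
pose n' := Ordinal nd.
have [Y [uY sY HY]] := AP_free_shift_growth hS (ha n') XS uX.
exists Y; split=> //.
  rewrite !expnS -mulnA; apply: leq_trans (leq_mul (leqnn k) sX) _.
  by rewrite mulnCA [X in (_ <= X)%N]mulnCA leq_mul2l sY orbT.
move=> y /HY[/HX[eps eps0 ->]|/HX[eps eps0 yE]].
  by exists eps => // i /ltnW; exact: eps0.
(* For a shifted point, coefficient [n'] is switched on; it was off before, so [a n'] is added
   exactly once. *)
exists (fun i => (i == n') || eps i) => [i ni|].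
  by rewrite negb_or eps0 1?ltnW // -val_eqE /= gtn_eqF.
rewrite -[LHS](subrK (a n')) yE -addrA; congr (_ + _).
rewrite (bigD1 n') //= [in RHS](bigD1 n') //= eqxx /=.
rewrite (negbTE (eps0 n' _)) //= mulr0n add0r mulr1n addrC; congr (_ + _).
by apply: eq_bigr => i /negbTE ->.
Qed.

Lemma hilbert_cube_dim (k d : nat) (S : set int) (a0 : int)
    (a : 'I_d -> int) (N : nat) :
  AP_free k S -> (forall i, a i != 0) ->
  hilbert_cube a0 a `<=` S `&` [set x | 1 <= x <= N%:Z] ->
  (k ^ d <= k.-1 ^ d * N)%N.
Proof.
move=> hS ha cubeS.
have [x /cubeS[]//|X [uX sX HX]] := hilbert_cube_large hS ha (a0 := a0).
apply: leq_trans sX _; rewrite leq_mul2l; apply/orP; right.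
rewrite -[N in (_ <= N)%N](size_iota 1) -(size_map Posz).
apply: uniq_leq_size => // x /HX/cubeS[_ /= /andP[x1 xN]].
by apply/mapP; exists `|x|%N; [rewrite mem_iota; lia | lia].
Qed.

Theorem theorem3 (R : realType) (k : nat) (S : set int) (c : R)
    (hk : (3 <= k)%N) (hS : AP_free k S)
    (hc1 : 1 < c) (hck : c < k%:R / (k%:R - 1)) :
  exists N0 : int, forall N : int, N0 <= N ->
    forall (d : nat) (a0 : int) (a : 'I_d -> int),
      0 <= a0 -> (forall i, 0 < a i) -> injective a ->
      hilbert_cube a0 a `<=` S `&` [set x | 1 <= x <= N] ->
      d%:R <= 2 * (k%:R - 2) / ((k%:R - 1) * ln c) * ln (N%:~R : R).
Proof.
(* The bound holds for every positive [N], so the threshold is 1; from here on [N.+1] stands for the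
   original [N]. *)
exists 1 => -[[//|N] _|//] d a0 a _ apos _ cubeS.
have dim : (k ^ d <= k.-1 ^ d * N.+1)%N.
  by apply: hilbert_cube_dim hS _ cubeS => i; rewrite gt_eqF.
have k3 : (3 : R) <= k%:R by rewrite (ler_nat _ 3).
have k1 : 0 < (k%:R : R) - 1 by lra.
have kpE : (k.-1%:R : R) = k%:R - 1 by rewrite -subn1 natrB //; lia.
have lnc : 0 < ln c by exact: ln_gt0.
have c0 : 0 < c by exact: lt_trans hc1.
have cN : c ^+ d <= N.+1%:R.
  apply: (@le_trans _ _ ((k%:R / (k%:R - 1)) ^+ d)).
    by rewrite lerXn2r ?nnegrE ?ltW // divr_gt0 //; lra.
  rewrite expr_div_n ler_pdivrMr ?exprn_gt0 // -kpE -!natrX -natrM ler_nat.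
  by rewrite mulnC.
have dlnc : d%:R * ln c <= ln (N.+1%:R : R).
  by rewrite mulr_natl -lnXn // ler_ln ?posrE ?exprn_gt0.
have lnN : 0 <= ln (N.+1%:R : R) by rewrite ln_ge0 // ler1n.
rewrite -[(Posz N.+1)%:~R]/(N.+1%:R) mulrAC ler_pdivlMr ?mulr_gt0 //.
(* It remains to compare [k - 1] with [2 * (k - 2)], which [3 <= k] settles since the logarithm is
   nonnegative. *)
rewrite mulrCA; apply: (@le_trans _ _ ((k%:R - 1) * ln N.+1%:R)).
  by rewrite ler_pM2l.
by rewrite ler_wpM2r //; lra.
Qed.
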